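(* Let $\mathcal{P}_n$ be the set of partitions of the vertex set of the $n\times n$ grid graph $G_n$ into $n$ disjoint parts, each inducing a connected subgraph with exactly $n$ vertices. For $\varepsilon>0$ let $\mathcal{C}_n(\varepsilon)\subseteq\mathcal{P}_n$ be the set of partitions $P\in\mathcal{P}_n$ with $\mathrm{cut}(P)\le \varepsilon n^2$. Then for all sufficiently small $\varepsilon>0$, \[\lim_{n\to\infty}\frac{|\mathcal{C}_n(\varepsilon)|}{|\mathcal{P}_n|} = 0.\]
   Context: $G_n$ is the $n\times n$ grid graph: vertex set $\{1,\dots,n\}^2$, two vertices adjacent iff they differ by $1$ in exactly one coordinate (so $G_n$ has $2n(n-1)$ edges). Such partitions correspond bijectively to tilings of the $n\times n$ square grid by $n$-ominoes. For a partition $P$ of the vertices of $G_n$, the cut score $\mathrm{cut}(P)$ is the number of edges $\{u,v\}$ of $G_n$ whose endpoints $u$ and $v$ lie in different parts of $P$. *)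

(* Defs.v *)
From mathcomp Require Import all_boot all_order all_algebra.
From mathcomp Require Import reals.

Set Implicit Arguments.
Unset Strict Implicit.
Unset Printing Implicit Defensive.

Import Order.TTheory GRing.Theory Num.Theory.

Local Open Scope ring_scope.

(* Coordinates range over {0, ..., n-1} instead of {1, ..., n}. *)
Notation vertex n := ('I_n * 'I_n)%type.

Definition consecutive (i j : nat) : bool := (i.+1 == j) || (j.+1 == i).

(* The other coordinate must agree, which yields 2n(n-1) edges. *)
Definition grid_adj (n : nat) : rel (vertex n) :=
  fun u v => ((u.1 == v.1) && consecutive u.2 v.2)
          || ((u.2 == v.2) && consecutive u.1 v.1).

Definition induced (T : finType) (e : rel T) (B : {set T}) : rel T :=
  fun x y => [&& x \in B, y \in B & e x y].

(* This also holds for B = set0; parts of a [finset.partition] are never empty. *)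
Definition induces_connected (T : finType) (e : rel T) (B : {set T}) : bool :=
  [forall x in B, forall y in B, connect (induced e B) x y].

Definition grid_partitions (n : nat) : {set {set {set vertex n}}} :=
  [set P : {set {set vertex n}} |
    [&& finset.partition P [set: vertex n],
        #|P| == n
      & [forall B in P,
           (#|B| == n) && induces_connected (@grid_adj n) B]]].

(* Cut edges are unordered pairs, so each of them is counted once. *)
Definition cut_edges (n : nat) (P : {set {set vertex n}}) : {set {set vertex n}} :=
  [set e : {set vertex n} |
    [exists u : vertex n, exists v : vertex n,
       [&& e == [set u; v], grid_adj u v & pblock P u != pblock P v]]].

Definition cut (n : nat) (P : {set {set vertex n}}) : nat := #|cut_edges P|.

Definition low_cut_partitions (R : realType) (n : nat) (eps : R) :
    {set {set {set vertex n}}} :=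
  [set P in grid_partitions n | (cut P)%:R <= eps * n%:R ^+ 2].

(* Main.v *)
Require Import Defs.
From mathcomp Require Import all_boot all_order all_algebra zify.
From mathcomp Require Import reals.

(** A partition into connected parts is recovered from its set of cut edges, so
    the partitions with at most [n^2 / 512] cut edges are at most as many as the
    small subsets of a set of [2 n^2] edges; weighting a subset [A] by
    [X^-#|A|] with [X = 2^8] shows that there are at most [2^(q^2 / 2)] of
    them, where [q = n %/ 3]. On the other hand there are at least [2^(q^2)]
    partitions: in a strip of three rows, two parts run along the top and the
    bottom row and share the cells of the middle row, each of which may go to
    either part without disconnecting it; sizes are kept equal by splitting
    each pair of consecutive middle cells between the two parts. *)

Set Implicit Arguments.
Unset Strict Implicit.
Unset Printing Implicit Defensive.

(** * Two numerical estimates *)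

Lemma card_small_subsets (T : finType) (E : {set T}) (N K X : nat) :
  0 < X -> #|E| <= N ->
  #|[set A : {set T} | (A \subset E) && (#|A| <= K)]| * X ^ N
    <= X.+1 ^ N * X ^ K.
Proof.
move=> X0 leEN.
suff H : #|[set A : {set T} | (A \subset E) && (#|A| <= K)]| * X ^ #|E|
    <= X.+1 ^ #|E| * X ^ K.
  rewrite -(subnKC leEN) !expnD mulnA [leqRHS]mulnAC.
  by apply: leq_mul => //; case: (N - _) => [|k] //; rewrite leq_exp2r.
(* Binomial theorem, summed over subsets: each [A] with [#|A| <= K] contributes at least [X ^ #|E|]
   after multiplication by [X ^ K]. *)
have -> : X.+1 ^ #|E| = \sum_(A : {set T} | A \subset E) X ^ (#|E| - #|A|).
  rewrite -addn1 expnDn.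
  rewrite (partition_big (fun A : {set T} => inord #|A| : 'I_#|E|.+1) xpredT) //=.
  apply: eq_bigr => k _; rewrite exp1n muln1.
  rewrite -cards_draws -sum_nat_const.
  apply: eq_big => [A|A]; rewrite inE.
    case sAE: (A \subset E) => //=.
    by rewrite -val_eqE /= inordK // ltnS subset_leq_card.
  by case/andP=> _ /eqP->.
rewrite -sum1dep_card !big_distrl /=.
rewrite [leqRHS](bigID (fun A : {set T} => #|A| <= K)) /=.
apply: leq_trans (leq_addr _ _).
apply: leq_sum => A /andP[sAE leAK]; rewrite mul1n -expnD.
by apply: leq_pexp2l => //; move: (subset_leq_card sAE); lia.
Qed.

(** Bernoulli's inequality in the form (1 + 1/N)^m <= 1/(1 - m/N) with N = 2M, proved by induction
    on m and used at m = M. *)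
Lemma leq_expSn_double (M : nat) : 0 < M -> (M.*2).+1 ^ M <= 2 * M.*2 ^ M.
Proof.
move=> M0.
have H m : m <= M.*2 -> (M.*2).+1 ^ m * (M.*2 - m) <= M.*2 ^ m * M.*2.
  elim: m => [|m IHm] ltm; first by rewrite subn0.
  have {}IHm := IHm (ltnW ltm); rewrite !expnS.
  apply: leq_trans (_ : M.*2 * ((M.*2).+1 ^ m * (M.*2 - m)) <= _).
    by rewrite -mulnA mulnCA [leqRHS]mulnCA leq_mul2l; nia.
  by rewrite -mulnA leq_mul2l IHm orbT.
have := H M; rewrite -addnn addnK leq_addl => /(_ isT).
by rewrite mulnDr -mulnDl addnn -mul2n leq_mul2r; lia.
Qed.

(** * Upper bound: cut edges determine the partition *)

Lemma grid_adj_sym (n : nat) : symmetric (@grid_adj n).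
Proof.
move=> u v; rewrite /grid_adj /consecutive ![v.1 == _]eq_sym ![v.2 == _]eq_sym.
by rewrite [((v.2 : nat).+1 == _) || _]orbC [((v.1 : nat).+1 == _) || _]orbC.
Qed.

Definition grid_edges (n : nat) : {set {set vertex n}} :=
  [set e : {set vertex n} |
    [exists u : vertex n, exists v : vertex n, (e == [set u; v]) && grid_adj u v]].

Lemma card_grid_edges (n : nat) : #|grid_edges n| <= 2 * n ^ 2.
Proof.
(* An edge is encoded by its endpoint with the smaller coordinate and its direction. On the border
   [f] may return a singleton, which is harmless since [f] only has to cover the edges. *)
pose f (p : vertex n * bool) : {set vertex n} :=
  p.1 |: [set v : vertex n | if p.2 then (v.1 == p.1.1) && (v.2 == p.1.2.+1 :> nat)
                  else (v.2 == p.1.2) && (v.1 == p.1.1.+1 :> nat)].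
have sub : grid_edges n \subset f @: [set: vertex n * bool].
  have fE (u v : vertex n) b : (if b then (v.1 == u.1) && (v.2 == u.2.+1 :> nat)
      else (v.2 == u.2) && (v.1 == u.1.+1 :> nat)) ->
      [set u; v] \in f @: [set: vertex n * bool].
    move=> uv; apply/imsetP; exists (u, b); rewrite ?inE //.
    rewrite /f /=; congr (_ |: _); apply/setP => w; rewrite !inE.
    case: b uv => /andP[/eqP e1 /eqP e2];
      rewrite -pair_eqE /pair_eq /= e1 -?val_eqE /= e2 //.
    by rewrite andbC.
  apply/subsetP => e; rewrite inE => /existsP[u /existsP[v /andP[/eqP->]]].
  rewrite /grid_adj /consecutive.
  case/orP=> /andP[/eqP uv /orP[]/eqP e1].
  - by apply: (fE _ _ true); rewrite uv eqxx e1 eqxx.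
  - by rewrite setUC; apply: (fE _ _ true); rewrite uv eqxx e1 eqxx.
  - by apply: (fE _ _ false); rewrite uv eqxx e1 eqxx.
  - by rewrite setUC; apply: (fE _ _ false); rewrite uv eqxx e1 eqxx.
apply: leq_trans (subset_leq_card sub) _; apply: leq_trans (leq_imset_card _ _) _.
by rewrite cardsT !card_prod !card_ord card_bool mulnC expnS expn1.
Qed.

Lemma cut_edges_sub (n : nat) (P : {set {set vertex n}}) :
  cut_edges P \subset grid_edges n.
Proof.
apply/subsetP => e; rewrite !inE => /existsP[u /existsP[v /and3P[eE uv _]]].
by apply/existsP; exists u; apply/existsP; exists v; rewrite eE uv.
Qed.

Lemma mem_cut_edges (n : nat) (P : {set {set vertex n}}) (u v : vertex n) :
  grid_adj u v -> ([set u; v] \in cut_edges P) = (pblock P u != pblock P v).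
Proof.
move=> uv; rewrite inE; apply/existsP/idP => [[x /existsP[y]]|neq]; last first.
  by exists u; apply/existsP; exists v; rewrite eqxx uv neq.
case/and3P=> /eqP eE xy neq.
have : x \in [set u; v] by rewrite eE set21.
have : y \in [set u; v] by rewrite eE set22.
have : u \in [set x; y] by rewrite -eE set21.
have : v \in [set x; y] by rewrite -eE set22.
have nxy : x != y by apply: contraNneq neq => ->.
rewrite !inE => /pred2P[]-> /pred2P[]-> //; rewrite ?orbb.
- by rewrite eq_sym (negPf nxy).
- by rewrite [pblock P y == _]eq_sym.
- by rewrite (negPf nxy).
Qed.

Definition uncut_adj (n : nat) (P : {set {set vertex n}}) : rel (vertex n) :=
  fun u v => grid_adj u v && ([set u; v] \notin cut_edges P).

(** A path inside a part crosses no cut edge, and an uncut edge never leaves a part: the parts are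
    the components left after deleting the cut edges. *)
Lemma eq_pblock_connect (n : nat) (P : {set {set vertex n}}) :
  P \in grid_partitions n -> forall u v,
  (pblock P u == pblock P v) = connect (uncut_adj P) u v.
Proof.
rewrite inE => /and3P[partP _ /forall_inP conP] u v.
have memP w : w \in cover P by rewrite (cover_partition partP) inE.
have tiP := partition_trivIset partP.
apply/eqP/idP => [eq_uv|].
  have /andP[_ /forall_inP con] := conP _ (pblock_mem (memP u)).
  have uu : u \in pblock P u by rewrite mem_pblock.
  have vu : v \in pblock P u by rewrite eq_uv mem_pblock.
  have /forall_inP /(_ v vu) := con u uu.
  apply: connect_sub => x y /and3P[xu yu xy]; apply: connect1.
  rewrite /uncut_adj xy mem_cut_edges // negbK.
  by rewrite (same_pblock tiP xu) (same_pblock tiP yu) eqxx.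
case/connectP=> p; elim: p u => [|w p IHp] u /=; first by move=> _ ->.
case/andP=> /andP[uw]; rewrite mem_cut_edges // negbK => /eqP-> pw ev.
exact: IHp.
Qed.

Lemma cut_edges_inj (n : nat) : {in grid_partitions n &, injective (@cut_edges n)}.
Proof.
move=> P Q PP PQ eqC.
have eqPQ u v : (pblock P u == pblock P v) = (pblock Q u == pblock Q v).
  rewrite (eq_pblock_connect PP) (eq_pblock_connect PQ); apply: eq_connect => x y.
  by rewrite /uncut_adj eqC.
move: PP PQ; rewrite !inE => /and3P[partP _ _] /and3P[partQ _ _].
rewrite -(preim_partition_pblock partP) -(preim_partition_pblock partQ).
rewrite /preim_partition /equivalence_partition; apply: eq_imset => u.
by apply/setP => v; rewrite !inE eqPQ.
Qed.

(** [N] is left free so that it can later be a multiple of [(n %/ 3) ^ 2]. *)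
Lemma card_bounded_cut (n K N X : nat) : 0 < X -> 2 * n ^ 2 <= N ->
  #|[set P in grid_partitions n | cut P <= K]| * X ^ N <= X.+1 ^ N * X ^ K.
Proof.
move=> X0 leN.
apply: leq_trans (card_small_subsets K X0 (leq_trans (card_grid_edges n) leN)).
rewrite leq_mul2r; apply/orP; right.
rewrite -[leqLHS](card_in_imset (f := @cut_edges n)); last first.
  move=> P Q /setIdP[PP _] /setIdP[QQ _]. exact: (cut_edges_inj PP QQ).
apply/subset_leq_card/subsetP => _ /imsetP[P /setIdP[_ leK] ->].
by rewrite inE cut_edges_sub.
Qed.

(** * Lower bound: a family of tilings indexed by bits *)

Lemma induces_connected_rank (T : finType) (e : rel T) (B : {set T}) (rk : T -> nat) :
  symmetric e ->
  {in B, forall x, 0 < rk x -> exists2 y, y \in B & e x y && (rk y < rk x)} ->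
  {in B &, forall x y, rk x = 0 -> rk y = 0 -> x = y} ->
  induces_connected e B.
Proof.
move=> sym_e desc root_uniq.
have sym_i : connect_sym (induced e B).
  apply: sym_connect_sym => x y; rewrite /induced sym_e.
  by case: (x \in B); case: (y \in B).
(* Descending in rank links every element to one of rank 0, and that one is unique. *)
have root x : x \in B -> exists y, [/\ y \in B, rk y = 0 & connect (induced e B) x y].
  elim: {x}(rk x).+1 {-2}x (ltnSn (rk x)) => // m IHm x lexm xB.
  have [rk0|rk0] := posnP (rk x); first by exists x.
  have [y yB /andP[exy ltyx]] := desc x xB rk0.
  have [z [zB rkz yz]] := IHm y (leq_trans ltyx lexm) yB.
  exists z; split=> //; apply: connect_trans yz; apply: connect1.
  by rewrite /induced xB yB.
apply/forall_inP => x xB; apply/forall_inP => y yB.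
have [x' [x'B rkx xx']] := root x xB; have [y' [y'B rky yy']] := root y yB.
by apply: connect_trans xx' _; rewrite (root_uniq x' y') // sym_i.
Qed.

(* The colour of the cell in row [x] and column [y] of the square of side
   [3 * q + s]. Rows [3 * i, 3 * i + 1, 3 * i + 2] with [i < q] carry three
   parts: the top and bottom ones own the first [2 * q + s] cells of their row
   and exactly one of the two middle cells in each pair of columns [2 * j],
   [2 * j + 1] with [j < q], selected by [b i j]; the rest is the middle part.
   The last [s] rows are parts by themselves. *)
Definition tile (q s : nat) (b : nat -> nat -> bool) (x y : nat) : nat :=
  if 3 * q <= x then x else
  if x %% 3 == 1 then
    if y < 2 * q then
      if b (x %/ 3) (y %/ 2) (+) odd y then (x %/ 3) * 3 else (x %/ 3) * 3 + 2
    else x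
  else if y < 2 * q + s then x else (x %/ 3) * 3 + 1.

(* Numbers the cells of each part from 0 to [3 * q + s - 1]. *)
Definition tile_pos (q s x y : nat) : nat :=
  if 3 * q <= x then y else
  if x %% 3 == 1 then
    if y < 2 * q then 2 * q + s + y %/ 2 else y
  else if y < 2 * q + s then y else
  if x %% 3 == 0 then y - (2 * q + s) else y - (q + s).

(* Decreases along a walk, within each part, to a unique cell of rank 0. *)
Definition tile_rank (q s x y : nat) : nat :=
  if 3 * q <= x then y else
  if x %% 3 == 1 then
    if y < 2 * q then y.+1 else y - 2 * q
  else if y < 2 * q + s then y else (y - 2 * q).+1.

Lemma tile_lt (q s : nat) (b : nat -> nat -> bool) (x y : nat) :
  x < 3 * q + s -> y < 3 * q + s -> tile q s b x y < 3 * q + s.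
Proof. by rewrite /tile => *; do !case: ifP => ?; lia. Qed.

Lemma tile_pos_lt (q s x y : nat) :
  x < 3 * q + s -> y < 3 * q + s -> tile_pos q s x y < 3 * q + s.
Proof. by rewrite /tile_pos => *; do !case: ifP => ?; lia. Qed.

Lemma tile_inj (q s : nat) (b : nat -> nat -> bool) (x y x' y' : nat) :
    y < 3 * q + s -> y' < 3 * q + s ->
  tile q s b x y = tile q s b x' y' -> tile_pos q s x y = tile_pos q s x' y' ->
  (x = x') /\ (y = y').
Proof.
have par z : odd z = (z %% 2 == 1) by rewrite modn2; case: odd.
rewrite /tile /tile_pos !par => ly ly'.
have [leqx|gtx] := leqP (3 * q) x; have [leqx'|gtx'] := leqP (3 * q) x'.
- by lia.
- by do !case: ifP => ?; lia.
- by do !case: ifP => ?; lia.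
(* Equal tiles force the same band of three rows. In the same pair of columns both cells consult the
   same bit of [b]; in different pairs the tiles or the positions differ whatever the bits are. *)
have [ex|ex] := eqVneq (x %/ 3) (x' %/ 3); last by do !case: ifP => ?; lia.
have [ey|ey] := eqVneq (y %/ 2) (y' %/ 2).
  rewrite ex ey; case: (b _ _) => /=; do !case: ifP => ?; lia.
do !case: ifP => ?; lia.
Qed.

(** A cell of rank 0 is coloured by its own row, and its column is 0, or [2 * q] in a middle row. *)
Lemma tile_root (q s : nat) (b : nat -> nat -> bool) (x y x' y' : nat) :
  tile q s b x y = tile q s b x' y' ->
  tile_rank q s x y = 0 -> tile_rank q s x' y' = 0 -> (x = x') /\ (y = y').
Proof. by rewrite /tile /tile_rank; do !case: ifP => ?; lia. Qed.

Lemma tile_descent (q s : nat) (b : nat -> nat -> bool) (x y : nat) :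
    x < 3 * q + s -> y < 3 * q + s -> 0 < tile_rank q s x y ->
  exists x' y', [/\ x' < 3 * q + s, y' < 3 * q + s, tile q s b x' y' = tile q s b x y,
    tile_rank q s x' y' < tile_rank q s x y &
    (x == x') && consecutive y y' || (y == y') && consecutive x x'].
Proof.
move=> lx ly; rewrite /consecutive.
(* Cells whose walk goes left along their row. *)
pose left := (3 * q <= x) || (if x %% 3 == 1 then 2 * q <= y else y < 2 * q + s).
have [lf|lf] := boolP left.
  move=> rk; exists x, y.-1; move: lf rk; rewrite /left /tile /tile_rank.
  by do !case: ifP => ?; split; lia.
(* The other cells move vertically: a shared middle cell to the row owning it, the end of an outer
   row to the middle row. *)
pose x' := if x %% 3 == 1 then
   if b (x %/ 3) (y %/ 2) (+) odd y then x.-1 else x.+1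
   else if x %% 3 == 0 then x.+1 else x.-1.
have qx : x' %/ 3 = x %/ 3 by move: lf; rewrite /left /x'; do !case: ifP => ?; lia.
exists x', y; move: lf; rewrite /left /tile /tile_rank qx /x'.
by case E: (b _ _ (+) _); do !case: ifP => ?; split; lia.
Qed.

(** Reads the bits back from the tiling, so distinct choices give distinct partitions. *)
Lemma tile_tooth (q s : nat) (b : nat -> nat -> bool) (i j : nat) :
  i < q -> j < q ->
  (tile q s b (3 * i + 1) (2 * j) == tile q s b (3 * i) (2 * j)) = b i j.
Proof.
move=> li lj; rewrite /tile.
have -> : (3 * i + 1) %/ 3 = i by lia.
have -> : (3 * i) %/ 3 = i by lia.
have -> : (2 * j) %/ 2 = j by lia.
have -> : odd (2 * j) = false by rewrite mul2n odd_double.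
by rewrite addbF; case: (b i j); do !case: ifP => ?; lia.
Qed.

(** The pair (f, h) is an injection of the n by n square into itself, hence a bijection, and [h]
    numbers each fibre of [f] by all of ['I_n]. *)
Lemma card_fiber_of_inj_pair (n : nat) (f h : vertex n -> nat) :
    (forall u, f u < n) -> (forall u, h u < n) ->
    (forall u v, f u = f v -> h u = h v -> u = v) ->
  forall u, #|[set v | f u == f v]| = n.
Proof.
move=> fn hn inj u.
pose g v : vertex n := (Ordinal (fn v), Ordinal (hn v)).
have g_inj : injective g by move=> x y [fxy hxy]; apply: inj.
have [k gK kg] := injF_bij g_inj.
have -> : [set v | f u == f v] = [set k (Ordinal (fn u), i) | i in 'I_n].
  apply/setP => v; rewrite inE; apply/eqP/imsetP => [fuv|[i _ ->]].
    exists (Ordinal (hn v)) => //; rewrite -[LHS]gK; congr k.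
    by congr (_, _); apply: val_inj.
  by have := kg (Ordinal (fn u), i) => /(congr1 (fun p => val p.1)).
by rewrite card_imset ?card_ord // => i j /(can_inj kg) /(congr1 snd).
Qed.

Lemma preim_partition_grid (n : nat) (f h rk : vertex n -> nat) :
    (forall u, f u < n) -> (forall u, h u < n) ->
    (forall u v, f u = f v -> h u = h v -> u = v) ->
    (forall u, 0 < rk u -> exists v, [/\ f v = f u, rk v < rk u & grid_adj u v]) ->
    (forall u v, f u = f v -> rk u = 0 -> rk v = 0 -> u = v) ->
  preim_partition f [set: vertex n] \in grid_partitions n.
Proof.
move=> fn hn inj desc root.
have partP := preim_partitionP f [set: vertex n].
have cardB : {in preim_partition f [set: vertex n], forall B : {set vertex n}, #|B| = n}.
  move=> _ /imsetP[u _ ->]; rewrite -[RHS](card_fiber_of_inj_pair fn hn inj u).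
  by apply: eq_card => v; rewrite !inE.
rewrite inE partP /=; apply/andP; split.
  have := card_uniform_partition cardB partP.
  (* The count n * n = #parts * n can be cancelled only for n > 0; for n = 0 there are no vertices,
     hence no parts. *)
  rewrite cardsT card_prod card_ord => /eqP; case: (posnP n) => [n0 _|n0].
    rewrite [X in _ == X]n0 cards_eq0; apply/eqP/setP => B; rewrite inE.
    by apply/negbTE/negP => /imsetP[u _ _]; have := ltn_ord u.1; rewrite [ltnRHS]n0.
  by rewrite eqn_pmul2r // eq_sym.
apply/forall_inP => B BP; rewrite cardB // eqxx /=.
case/imsetP: BP => u _ ->; apply: (induces_connected_rank (rk := rk)).
- exact: grid_adj_sym.
- move=> x; rewrite !inE => /eqP ux /desc[y [yx rky xy]].
  by exists y; rewrite ?inE /= ?yx ?ux ?eqxx ?xy.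
- by move=> x y; rewrite !inE /= => /eqP ux /eqP uy; apply: root; rewrite -ux.
Qed.

(** [tile] reads its bits at natural numbers, while a finite function type is what can be
    counted. *)
Definition extend_by_false (q : nat) (b : {ffun 'I_q * 'I_q -> bool}) (i j : nat) : bool :=
  [exists p, [&& b p, p.1 == i :> nat & p.2 == j :> nat]].

Lemma extend_by_falseE (q : nat) (b : {ffun 'I_q * 'I_q -> bool}) (p : 'I_q * 'I_q) :
  extend_by_false b p.1 p.2 = b p.
Proof.
apply/existsP/idP => [[[i j] /and3P[bij /eqP ei /eqP ej]]|bp].
  by case: p ei ej => i' j' /= /val_inj <- /val_inj <-.
by exists p; rewrite bp !eqxx.
Qed.

Lemma card_grid_partitions_ge (n : nat) : 2 ^ (n %/ 3) ^ 2 <= #|grid_partitions n|.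
Proof.
set q := n %/ 3; pose s := n %% 3.
have nE : 3 * q + s = n by rewrite mulnC -divn_eq.
pose f (b : {ffun 'I_q * 'I_q -> bool}) (u : vertex n) := tile q s (extend_by_false b) u.1 u.2.
pose F (b : {ffun 'I_q * 'I_q -> bool}) := preim_partition (f b) [set: vertex n].
have F_inj : injective F.
  move=> b b' eqF; apply/ffunP => -[i j].
  have [li lj] := (ltn_ord i, ltn_ord j).
  have lt1 : 3 * i + 1 < n by lia.
  have lt0 : 3 * i < n by lia.
  have lt2 : 2 * j < n by lia.
  have eqv (c : {ffun 'I_q * 'I_q -> bool}) :
      {in [set: vertex n] & &, equivalence_rel (fun x y => f c x == f c y)}.
    by move=> x y z _ _ _; split=> [|/eqP->].
  have key (c : {ffun 'I_q * 'I_q -> bool}) : c (i, j) = ((Ordinal lt0, Ordinal lt2)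
      \in pblock (F c) (Ordinal lt1, Ordinal lt2)).
    rewrite (pblock_equivalence_partition (eqv c)) ?inE // /f /=.
    by rewrite tile_tooth // -(extend_by_falseE c (i, j)).
  by rewrite !key eqF.
have -> : 2 ^ q ^ 2 = #|F @: [set: {ffun 'I_q * 'I_q -> bool}]|.
  by rewrite card_imset // cardsT card_ffun card_bool card_prod card_ord mulnn.
apply/subset_leq_card/subsetP => _ /imsetP[b _ ->].
apply: (@preim_partition_grid _ _ (fun u => tile_pos q s u.1 u.2)
  (fun u => tile_rank q s u.1 u.2)).
- by move=> u; rewrite /f -[ltnRHS]nE; rewrite tile_lt // nE.
- by move=> u; rewrite -[ltnRHS]nE; rewrite tile_pos_lt // nE.
- move=> [x y] [x' y'] /= fe pe.
  have [||ex ey] := tile_inj _ _ fe pe; rewrite ?nE //.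
  by congr (_, _); apply: val_inj.
- move=> [x y] /(tile_descent (extend_by_false b)) /=; rewrite nE.
  case=> // x' [y' [lx ly e rk adj]].
  by exists (Ordinal lx, Ordinal ly); split.
- move=> [x y] [x' y'] /= fe rk rk'; have [ex ey] := tile_root fe rk rk'.
  by congr (_, _); apply: val_inj.
Qed.

(** * Comparison of the two bounds *)

Lemma card_low_cut_sq (n : nat) : 6 <= n ->
  #|[set P in grid_partitions n | cut P <= n ^ 2 %/ 512]| ^ 2 <= 2 ^ (n %/ 3) ^ 2.
Proof.
move=> n6; set L := #|_|; set q := n %/ 3.
(* Since q >= 2, n <= 3q + 2 <= 4q. *)
have leq : n ^ 2 <= 16 * q ^ 2 by rewrite /q; nia.
pose K := n ^ 2 %/ 512.
have leK : 32 * K <= q ^ 2 by rewrite /K; lia.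
have leN : 2 * n ^ 2 <= 32 * q ^ 2 by lia.
(* [X] is abstract to keep its powers symbolic. As X = 2 * 128, (X + 1)^128 <= 2 * X^128. *)
have [X XE] : {X | X = 2 ^ 8} by eexists.
have X0 : 0 < X by rewrite XE expn_gt0.
have := card_bounded_cut K X0 leN; rewrite -/L -/K.
have := @leq_expSn_double 128 isT.
have -> : 128.*2 = X by rewrite XE.
move=> leX leL.
(* Fourth powers turn the exponent 32 q^2 into 128 q^2: the ratio of the powers of X + 1 and X costs
   2^(q^2), and X^(4K) = 2^(32K) costs at most another 2^(q^2). *)
rewrite -(@leq_exp2r _ _ 2) // -(@leq_pmul2r ((X ^ (32 * q ^ 2)) ^ 4)) ?expn_gt0 ?X0 //.
rewrite -expnM -expnMn.
apply: leq_trans (_ : (X.+1 ^ (32 * q ^ 2) * X ^ K) ^ 4 <= _); first by rewrite leq_exp2r.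
rewrite expnMn -!expnM.
have -> : 32 * q ^ 2 * 4 = 128 * q ^ 2 by lia.
rewrite !(expnM _ 128).
apply: leq_trans (_ : (2 * X ^ 128) ^ (q ^ 2) * 2 ^ (q ^ 2) <= _).
  apply: leq_mul; first by case: (q ^ 2) => // m; rewrite leq_exp2r.
  by rewrite XE -expnM leq_pexp2l //; lia.
by rewrite expnMn muln2 -addnn expnD mulnAC.
Qed.

(** The exponential decay is weakened to 3/(n + 1), a multiple of the harmonic sequence. *)
Lemma card_low_cut_ratio (n : nat) : 6 <= n ->
  n.+1 * #|[set P in grid_partitions n | cut P <= n ^ 2 %/ 512]|
    <= 3 * #|grid_partitions n|.
Proof.
move=> n6; apply: leq_trans (leq_mul (leqnn 3) (card_grid_partitions_ge n)).
have := card_low_cut_sq n6; set L := #|_|; set q := n %/ 3 => leL.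
have nq : n.+1 <= 3 * q.+1 by rewrite /q; lia.
apply: leq_trans (leq_mul nq (leqnn L)) _; rewrite -mulnA leq_mul2l /=.
rewrite -(@leq_exp2r _ _ 2) // expnMn -[leqRHS]mulnn; apply: leq_mul => //.
(* (q + 1)^2 <= 2^(2q) <= 2^(q^2), as q >= 2. *)
apply: leq_trans (_ : (2 ^ q) ^ 2 <= _); first by rewrite leq_exp2r // ltn_expl.
by rewrite -expnM leq_pexp2l // leq_mul2l; rewrite /q; lia.
Qed.

(** * Passage to the limit *)

Import Order.TTheory GRing.Theory Num.Theory.

Lemma low_cut_partitions_sub (R : realType) (n : nat) (eps : R) :
  (eps < 512%:R^-1)%R ->
  low_cut_partitions n eps
    \subset [set P in grid_partitions n | cut P <= n ^ 2 %/ 512].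
Proof.
move=> eps_lt; apply/subsetP => P /setIdP[PP cutP].
rewrite inE PP /= leq_divRL // -(ler_nat R) natrM natrX.
rewrite -ler_pdivlMr ?ltr0n // mulrC; apply: le_trans cutP _.
by rewrite ler_wpM2r ?exprn_ge0 ?ler0n // ltW.
Qed.

From mathcomp Require Import all_classical all_reals all_analysis.
Import numFieldNormedType.Exports.
Local Open Scope classical_set_scope.
Local Open Scope ring_scope.

Theorem theorem3 (R : realType) :
  exists2 eps0 : R, 0 < eps0 &
    forall eps : R, 0 < eps -> eps < eps0 ->
      (fun n : nat => #|low_cut_partitions n eps|%:R / #|grid_partitions n|%:R : R)
        @ \oo --> (0 : R).
Proof.
exists 512%:R^-1; first by rewrite invr_gt0 ltr0n.
move=> eps _ eps_lt.
apply: (@squeeze_cvgr _ _ _ _ (fun=> 0) (fun n => 3%:R * harmonic n)).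
- near=> n.
  have n6 : (6 <= n)%N by near: n; exists 6%N.
  rewrite divr_ge0 ?ler0n //=.
  have grid_gt0 : (0 < #|grid_partitions n|)%N.
    by apply: leq_trans (card_grid_partitions_ge n); rewrite expn_gt0.
  rewrite ler_pdivrMr ?ltr0n // mulrAC ler_pdivlMr ?ltr0n // -!natrM ler_nat mulnC.
  apply: leq_trans (card_low_cut_ratio n6).
  by rewrite leq_mul2l (subset_leq_card (low_cut_partitions_sub n eps_lt)) orbT.
- exact: cvg_cst.
- by rewrite -[X in _ --> X](mulr0 3%:R); apply: cvgMr; exact: cvg_harmonic.
Unshelve. all: by end_near.
Qed.
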